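(* Let $z \ge 1$ be an integer and let $n$ be an integer such that $\ell(z) \le n < \ell(z+1)$. If $n \neq 8$, then $b(n) = n^2 - zn + b(z)$.
   Context: A reachable pair of a digraph $\Gamma$ is an ordered pair $(\alpha,\beta)$ of (not necessarily distinct) vertices such that there is a directed path (possibly of length $0$) from $\alpha$ to $\beta$; the weight $w(\Gamma)$ is the number of reachable pairs. For $n\in\mathbb{N}$, $W(n)$ is the set of all integers $k$ such that some digraph on $n$ vertices has weight $k$. For $n \in \mathbb{N}$, $b(n)$ is the largest integer such that every integer $k$ with $n \le k \le b(n)$ lies in $W(n)$ (equivalently, the least integer $b(n)\ge n$ such that no digraph on $n$ vertices has exactly $b(n)+1$ reachable pairs). Define $\ell(z) := b(z) - z + 3$ for $z\in\mathbb{N}$. *)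

(* Defs.v *)
From mathcomp Require Import all_boot all_order all_algebra.

Set Implicit Arguments.
Unset Strict Implicit.
Unset Printing Implicit Defensive.

Import GRing.Theory.

Local Open Scope nat_scope.

(* A digraph on n vertices, given by its set of arcs. Loops are not excluded:
   they do not affect reachability, which is reflexive in any case. *)
Definition digraph (n : nat) := {set 'I_n * 'I_n}.

Definition arc n (G : digraph n) : rel 'I_n := [rel x y | (x, y) \in G].

Definition reachable_pairs n (G : digraph n) : {set 'I_n * 'I_n} :=
  [set p | connect (arc G) p.1 p.2].

Definition weight n (G : digraph n) : nat := #|reachable_pairs G|.

Definition W (n : nat) : pred nat :=
  [pred k | [exists G : digraph n, weight G == k]].

Definition filled (n : nat) : pred nat :=
  [pred m | [forall k : 'I_m.+1, (n <= k) ==> (val k \in W n)]].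

Lemma weight_set0 n : weight (set0 : digraph n) = n.
Proof.
rewrite /weight -[RHS]card_ord.
rewrite -(card_image (f := fun x : 'I_n => (x, x))); last by move=> x y [].
apply: eq_card => -[x y]; rewrite inE /=.
apply/connectP/imageP => [[[|z p] /= e ->] | [u _ [-> ->]]].
- by exists x.
- by case/andP: e; rewrite /arc /= in_set0.
- by exists [::].
Qed.

Lemma weight_le n (G : digraph n) : weight G <= n ^ 2.
Proof. by rewrite (leq_trans (max_card _)) // card_prod card_ord mulnn. Qed.

Lemma filled_self n : n \in filled n.
Proof.
apply/forallP => k; apply/implyP => nk.
have -> : val k = n by apply/eqP; rewrite eqn_leq nk -ltnS ltn_ord.
by apply/existsP; exists set0; rewrite weight_set0.
Qed.

Lemma filled_ex n : exists m, m \in filled n.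
Proof. by exists n; exact: filled_self. Qed.

Lemma filled_bound n m : m \in filled n -> m <= n ^ 2.
Proof.
move=> /forallP/(_ ord_max)/implyP/= h; rewrite leqNgt; apply/negP => lt.
have le_n : n <= m.
  by rewrite (leq_trans _ (ltnW lt)) // -mulnn; case: n {h lt} => // n; exact: leq_pmulr.
have /existsP[G /eqP wG] := h le_n.
by move: lt; rewrite -wG ltnNge weight_le.
Qed.

Definition b (n : nat) : nat := ex_maxn (filled_ex n) (@filled_bound n).

Local Open Scope ring_scope.

Definition ell (z : nat) : int := (b z)%:Z - z%:Z + 3.

(* Main.v *)
(** Let [C] be a largest strongly connected class of a preorder on [n] points,
    [j = n - #|C|], and let [m] be the number of points comparable to no point
    of [C]. With [w'] the weight outside [C] and [t = j + m], the weight is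
    [n^2 - t n + u] where [u = w' + j m]. Suppose that this is
    [n^2 - z n + b z + 1]. If [j > z], the bound
    [n^2 + \sum_x #|class of x|] on twice the weight is too small, because
    [2 b z >= z^2 + 3 z - 2] for [z <> 3]; for [z = 3] the only [n] in doubt are
    [7], which a second estimate settles, and the true exception [8].
    If [j <= z], comparing sizes leaves only [t = z] and [u = b z + 1]; but then
    shrinking [C] to [m] points gives a preorder on [z] points of weight
    [b z + 1], which does not exist.
    Conversely, a full class of size [n - j] below a preorder on [j] points has
    weight in [n^2 - j n + W j]. When [n < ell (z + 1)], the intervals
    [[n^2 - j n + j, n^2 - j n + b j]] for [z <= j < n] leave no gap, and
    adding an isolated point to a preorder on [n - 1] points fills the rest. *)
Require Import Defs.
From mathcomp Require Import all_boot all_order all_algebra.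
From mathcomp Require Import zify.

Import GRing.Theory.

Local Open Scope nat_scope.

(** * Weights of relations on finite sets *)

Definition rel_weight {T : finType} (r : rel T) (A : {set T}) : nat :=
  \sum_(x in A) \sum_(y in A) r x y.

Lemma rel_weightT {T : finType} (r : rel T) :
  rel_weight r [set: T] = \sum_x \sum_y r x y.
Proof.
rewrite /rel_weight; under eq_bigl do rewrite inE.
by apply: eq_bigr => x _; apply: eq_bigl => y; rewrite inE.
Qed.

Lemma weightE {n} (G : digraph n) :
  weight G = rel_weight (connect (Defs.arc G)) [set: 'I_n].
Proof.
rewrite /rel_weight (pair_big (mem setT) (mem setT)
  (fun x y => nat_of_bool (connect (Defs.arc G) x y))) /=.
rewrite /weight -sum1_card big_mkcond [RHS]big_mkcond /=.
by apply: eq_bigr => -[x y] _; rewrite !inE /=; case: connect.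
Qed.

(** A preorder is its own reachability relation; [enum_val] numbers the points of [A]. *)
Lemma rel_weight_in_W {T : finType} {r : rel T} (A : {set T}) :
  reflexive r -> transitive r -> rel_weight r A \in W #|A|.
Proof.
move=> rr rt; apply/existsP.
pose G : digraph #|A| := [set p | r (enum_val p.1) (enum_val p.2)].
exists G; rewrite weightE.
have cG x y : connect (Defs.arc G) x y = r (enum_val x) (enum_val y).
  apply/idP/idP => [/connectP[p] |]; last first.
    by move=> rxy; apply: connect1; rewrite /Defs.arc /= inE.
  elim: p x => [|z p IH] x /=; first by move=> _ ->.
  by case/andP; rewrite /Defs.arc /= inE => rxz /IH{}IH /IH; apply: rt.
rewrite /rel_weight [X in _ == X]big_enum_val /=.
rewrite big_mkcond /=; apply/eqP/eq_bigr => x _; rewrite inE.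
rewrite [RHS]big_enum_val big_mkcond /=; apply: eq_bigr => y _.
by rewrite inE cG.
Qed.

Lemma in_W_rel {n k} : k \in W n ->
  exists r : rel 'I_n, [/\ reflexive r, transitive r
    & k = rel_weight r [set: 'I_n]].
Proof.
case/existsP => G /eqP <-; exists (connect (Defs.arc G)); rewrite weightE.
by split=> //; exact: connect_trans.
Qed.

Lemma rel_weight_le {T : finType} (r : rel T) (A : {set T}) :
  rel_weight r A <= #|A| * #|A|.
Proof.
rewrite -sum_nat_const; apply: leq_sum => x _.
by rewrite -sum1_card; apply: leq_sum => y _; case: (r x y).
Qed.

Lemma rel_weight_ge {T : finType} {r : rel T} (A : {set T}) :
  reflexive r -> #|A| <= rel_weight r A.
Proof.
move=> rr; rewrite -sum1_card; apply: leq_sum => x xA.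
by rewrite (bigD1 x) //= rr.
Qed.

(** A complete class of [c] points is added to a preorder on [j] points: it reaches all of them if
    [d] holds, and is isolated from them otherwise. *)
Lemma W_extend c (d : bool) {j w n k} :
  w \in W j -> n = c + j -> k = c * c + d * (c * j) + w -> k \in W n.
Proof.
case/in_W_rel => r [rr rt ->] -> ->.
pose s (x y : 'I_c + 'I_j) := match x, y with
  | inl _, inl _ => true | inl _, inr _ => d
  | inr _, inl _ => false | inr u, inr v => r u v end.
have sr : reflexive s by case=> x /=.
have st : transitive s by move=> [y|y] [x|x] [z|z] //=; apply: rt.
have -> : c + j = #|[set: 'I_c + 'I_j]| by rewrite cardsT card_sum !card_ord.
have <- : rel_weight s setT = c * c + d * (c * j) + rel_weight r setT.
  rewrite !rel_weightT big_sumType /=; congr (_ + _).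
    under eq_bigr do rewrite big_sumType /= !sum_nat_const !card_ord.
    by rewrite sum_nat_const card_ord; lia.
  by apply: eq_bigr => x _; rewrite big_sumType /= sum_nat_const muln0.
exact: rel_weight_in_W.
Qed.

(** * Elementary properties and lower bounds of [b] *)

Lemma b_in_W n k : n <= k <= b n -> k \in W n.
Proof.
case/andP => nk; rewrite /b; case: ex_maxnP => m /forallP fm _ km.
by have /implyP/(_ nk) := fm (Ordinal (km : k < m.+1)).
Qed.

Lemma b_ge n m : (forall k, n <= k <= m -> k \in W n) -> m <= b n.
Proof.
move=> h; rewrite /b; case: ex_maxnP => p _; apply.
by apply/forallP => k; apply/implyP => nk; apply: h; rewrite nk -ltnS ltn_ord.
Qed.

Lemma b_ge_self n : n <= b n.
Proof.
by apply: b_ge => k; rewrite -eqn_leq => /eqP <-; apply/existsP; exists set0;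
  rewrite weight_set0.
Qed.

Lemma b_succ_notin_W n : (b n).+1 \notin W n.
Proof.
apply/negP => h; suff: (b n).+1 <= b n by rewrite ltnn.
apply: b_ge => k /andP[nk]; rewrite leq_eqVlt ltnS => /predU1P[-> //|kb].
by apply: b_in_W; rewrite nk.
Qed.

Lemma b_eq n m : n <= m.+1 -> m <= b n -> m.+1 \notin W n -> b n = m.
Proof.
move=> nm mb; apply: contraNeq => ne; apply: b_in_W.
by rewrite nm ltn_neqAle eq_sym ne.
Qed.

Lemma b_ltS n : b n < b n.+1.
Proof.
apply: b_ge => k /andP[nk kb]; have kW : k.-1 \in W n by apply: b_in_W; lia.
by apply: (W_extend 1 false kW); lia.
Qed.

Lemma b_addn n i : b n + i <= b (n + i).
Proof.
by elim: i => [|i IH]; rewrite ?addn0 // !addnS (leq_ltn_trans IH) // b_ltS.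
Qed.

Lemma b_2_ge : 4 <= b 2.
Proof.
have W0 : 0 \in W 0 by apply: b_in_W.
have W1 : 1 \in W 1 by apply: b_in_W; rewrite b_ge_self.
apply: b_ge => -[|[|[|[|[|k]]]]] // _.
- by apply: (W_extend 1 false W1).
- by apply: (W_extend 1 true W1).
- by apply: (W_extend 2 true W0).
Qed.

Lemma b_lower z n : z.+1 < n -> n + z < b z.+1 + 2 ->
  (n - z) * n + b z <= b n.
Proof.
move=> zn nb.
have fill j k :
    j <= n -> (n - j) * n + j <= k <= (n - j) * n + b j -> k \in W n.
  move=> jn kj; have jW : k - (n - j) * n \in W j by apply: b_in_W; lia.
  by apply: (W_extend (n - j) true jW); nia.
(* The interval for [j] starts at most one past the end of that for [j.+1]; [b_addn] carries this
   from [z] to all larger [j]. *)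
have gap j : z <= j -> n + j <= b j.+1 + 1.
  by move=> zj; have := b_addn z.+1 (j - z); rewrite addSn subnKC //; lia.
suff H i : i <= n.-1 - z -> forall k,
    n <= k <= i.+1 * n + b (n.-1 - i) -> k \in W n.
  apply: b_ge => k hk; apply: (H (n.-1 - z) (leqnn _)).
  by rewrite (_ : (n.-1 - z).+1 = n - z) ?subKn //; lia.
elim: i => [|i IH] ilt k /andP[nk].
  (* Below the interval of [n.-1], an isolated point yields the values up to [b n.-1 + 1]. *)
  rewrite mul1n subn0 => kb; have [lek|ltk] := leqP k (b n.-1).+1.
    have kW : k.-1 \in W n.-1 by apply: b_in_W; lia.
    by apply: (W_extend 1 false kW); lia.
  apply: (fill n.-1); first lia.
  have -> : n - n.-1 = 1 by lia.
  by have := gap n.-2; rewrite (_ : n.-2.+1 = n.-1); lia.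
move=> kb; have [lek|ltk] := leqP k (i.+1 * n + b (n.-1 - i)).
  by apply: IH; rewrite ?nk //; lia.
apply: (fill (n.-1 - i.+1)); first lia.
have -> : n - (n.-1 - i.+1) = i.+2 by lia.
have := gap (n.-1 - i.+1); rewrite (_ : (n.-1 - i.+1).+1 = n.-1 - i); last lia.
by rewrite mulSn in kb *; lia.
Qed.

Lemma b_3_ge : 7 <= b 3.
Proof. by have := b_lower 1 3; have := b_2_ge; have := b_ge_self 1; lia. Qed.

(** Strong induction through [b_lower], with [z] half of [n] rounded up; for [n >= 7] both [z] and
    [z.+1] are past the exceptional value 3. *)
Lemma b_quadratic n : 0 < n -> n != 3 -> n * n + 3 * n <= 2 * b n + 2.
Proof.
have b1 := b_ge_self 1; have b2 := b_2_ge; have b3 := b_3_ge.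
have b4 := b_lower 1 4; have b5 := b_lower 2 5; have b6 := b_lower 2 6.
elim/ltn_ind: n => n IH n0 n3; have [n7|n7] := ltnP n 7.
  by case: n {IH} n0 n3 n7 => [|[|[|[|[|[|[|n]]]]]]] //; lia.
pose z := uphalf n.
have [nz zn] : (n = 2 * z \/ n = 2 * z - 1) /\ 4 <= z by rewrite /z; lia.
have /= IHz := IH z; have /= IHSz := IH z.+1; have := b_lower z n.
by clearbody z; case: nz => nz; subst n; nia.
Qed.

(** * Classes of a preorder and the resulting estimates *)

Definition rel_class {T : finType} (r : rel T) (x : T) : {set T} :=
  [set y | r x y && r y x].

Lemma rel_class_eq {T : finType} {r : rel T} {x y : T} :
  transitive r -> y \in rel_class r x -> rel_class r y = rel_class r x.
Proof.
move=> rt; rewrite inE => /andP[xy yx]; apply/setP => u; rewrite !inE.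
by apply/andP/andP => -[]; split; apply: rt; eauto.
Qed.

(** For each pair, [r x y + r y x] is at most 1 plus the indicator of [y] lying in the class of
    [x]. *)
Lemma double_rel_weight {T : finType} (r : rel T) :
  2 * rel_weight r [set: T] <= #|T| * #|T| + \sum_x #|rel_class r x|.
Proof.
rewrite mul2n -addnn rel_weightT [X in X + _]exchange_big -big_split /=.
rewrite -sum_nat_const -big_split /=; apply: leq_sum => x _.
rewrite -[X in _ <= X + _]sum1_card -[X in _ <= _ + X]sum1_card.
rewrite -big_split (big_mkcond (mem (rel_class r x))) /= -big_split /=.
by apply: leq_sum => y _; rewrite inE; case: (r x y); case: (r y x).
Qed.

(* Stated for a part [B] of the class, so that the class can be shrunk. *)
Lemma rel_weight_class {T : finType} {r : rel T} {x0 : T} {B : {set T}} :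
  transitive r -> B \subset rel_class r x0 ->
  let D := ~: rel_class r x0 in
  rel_weight r (B :|: D) =
    #|B| * #|B| + #|B| * #|[set x in D | r x x0 || r x0 x]| + rel_weight r D.
Proof.
move=> rt /subsetP BC D.
have disjBD : [disjoint B & D].
  by rewrite disjoints_subset setCK; apply/subsetP.
have eqr x y : x \in B -> (r x y = r x0 y) * (r y x = r y x0).
  move/BC; rewrite inE => /andP[x0x xx0].
  by split; apply/idP/idP => h; apply: rt h _ || apply: rt _ h.
have splitBD (F : T -> nat) :
    \sum_(x in B :|: D) F x = \sum_(x in B) F x + \sum_(x in D) F x.
  by rewrite -bigU //; apply: eq_bigl => x; rewrite inE.
rewrite /rel_weight splitBD; under eq_bigr do rewrite splitBD.
under [X in _ + X = _]eq_bigr do rewrite splitBD.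
rewrite !big_split /= !addnA; congr (_ + _).
rewrite -addnA; congr (_ + _).
  rewrite -sum_nat_const; apply: eq_bigr => x xB.
  rewrite -sum1_card; apply: eq_bigr => y yB.
  by rewrite eqr //; have := BC _ yB; rewrite inE => /andP[->].
(* A point outside the class is related to it in at most one direction, so the cross terms count
   each comparable point once per element of [B]. *)
rewrite [X in _ + X = _]exchange_big -big_split -sum_nat_const /=.
apply: eq_bigr => x xB; rewrite -big_split -sum1_card [RHS]big_mkcond /=.
rewrite [LHS]big_mkcond; apply: eq_bigr => y; rewrite !inE !(eqr x y xB).
by case: (r x0 y); case: (r y x0).
Qed.

(** Two bounds on the sum of class sizes: no class exceeds [c], and every class other than the
    chosen largest one lies in its complement. *)
Lemma double_rel_weight_max_class {T : finType} {r : rel T} {x0 : T} :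
  transitive r -> (forall x, #|rel_class r x| <= #|rel_class r x0|) ->
  let c := #|rel_class r x0| in
  2 * rel_weight r [set: T] <= #|T| * #|T| + #|T| * c /\
  2 * rel_weight r [set: T] <= #|T| * #|T| + (c * c + (#|T| - c) * (#|T| - c)).
Proof.
move=> rt cmax c; have le2 := double_rel_weight r.
split; apply: (leq_trans le2); rewrite leq_add2l.
  by rewrite -sum_nat_const; apply: leq_sum.
rewrite (bigID (mem (rel_class r x0))) /= leq_add //.
  by rewrite -sum_nat_const; apply: leq_sum.
have -> : #|T| - c = #|~: rel_class r x0|.
  by rewrite -(cardsC (rel_class r x0)) addKn.
rewrite -sum_nat_const big_mkcond [X in _ <= X]big_mkcond /=.
apply: leq_sum => x _; rewrite [_ \in ~: _]in_setC; case: ifP => // xC.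
apply/subset_leq_card/subsetP => y yx; rewrite inE; apply: contra xC => yx0.
rewrite -(rel_class_eq rt yx0) (rel_class_eq rt yx) inE.
by move: yx; rewrite inE => /andP[xy yx]; rewrite (rt _ _ _ xy yx).
Qed.

(* [bz] stands for [b z], the other variables are those of the header. *)
Lemma class_arith n z bz c m j w' :
  n = c + j -> m <= j -> j <= z -> 0 < z -> z.+1 < n ->
  j <= w' -> w' <= j * j ->
  bz + 3 <= n + z -> z * z + z < n + bz + 1 ->
  c * c + c * (j - m) + w' = (n - z) * n + bz + 1 ->
  j + m = z /\ m * m + m * (j - m) + w' = bz + 1.
Proof.
move=> nE mj jz z0 zn jw wj bn nb E.
have {}E : n * z + w' + j * m = n * (j + m) + bz + 1.
  have [k jE] : exists k, j = m + k by exists (j - m); lia.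
  have [e eE] : exists e, n = z + e by exists (n - z); lia.
  move: E; rewrite jE addKn {1}eE addKn => E.
  have := congr1 (muln n) eE; have := congr1 (muln n) nE.
  have := congr1 (muln c) nE; have := congr1 (muln m) nE; rewrite jE.
  clear - E; lia.
have w'jm : w' + j * m <= z * (j + m).
  by have := leq_mul2r (j + m) j z; rewrite jz orbT; clear - wj; lia.
(* With [t = j + m] and [u = w' + j * m], [E] says [u + n * z = n * t + bz + 1]. The bound [t <= u]
   excludes [t < z], and [u <= z * t] excludes [t > z]. *)
have [lt|gt|eq] := ltngtP (j + m) z.
- have jm : m <= j * m by case: (j) mj => [|i]; [case: (m) | rewrite leq_pmull].
  have : n.-1 * (j + m).+1 <= n.-1 * z by rewrite leq_mul2l lt orbT.
  have [n' n'E] : exists n', n = n'.+1 by exists n.-1; lia.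
  by rewrite n'E in E bn *; clear - E bn jw jm; lia.
- have [d dE] : exists d, j + m = z + d.+1 by exists (j + m - z).-1; lia.
  have : z * d <= n * d by rewrite leq_mul2r orbC (ltnW (ltnW zn)).
  by rewrite dE in E w'jm; clear - E w'jm nb; lia.
- split => //; rewrite eq in E w'jm.
  have [k jE] : exists k, j = m + k by exists (j - m); lia.
  by rewrite jE addKn; rewrite jE in E; clear - E; lia.
Qed.

Lemma small_class_arith n z bz c w :
  c <= n -> z < n - c -> z * z + 2 * z < n + bz ->
  2 * w <= n * n + n * c ->
  2 * w <= n * n + (c * c + (n - c) * (n - c)) ->
  w + z * n <> n * n + bz + 1.
Proof.
move=> cn zc nb le1 le2 wE.
have [cle|clt] := leqP (2 * c) n.
  have nc : n * (2 * c) <= n * n by rewrite leq_mul2l cle orbT.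
  (* Over the integers this is [(n - 2 * z - 2)^2 + 4 <= 0]; the cases on [n] avoid truncated
     subtraction. *)
  have key : n * n + 4 * (z * z) + 8 * z + 8 <= 4 * (z * n) + 4 * n by lia.
  have [le|/ltnW le] := leqP n (2 * z + 2).
    have zE : 2 * z + 2 = n + (2 * z + 2 - n) by lia.
    move: (2 * z + 2 - n) zE => e zE; have := congr1 (fun x => x * x) zE.
    by clear - key; nia.
  have nE : n = 2 * z + 2 + (n - (2 * z + 2)) by lia.
  by move: (n - _) nE => e nE; rewrite nE in key; clear - key; nia.
have [d dE] : exists d, n - c = z + d.+1 by exists (n - c - z).-1; lia.
have nE : n = c + z + d.+1 by lia.
(* From [n < 2 * c], [n] exceeds [2 * (n - c) = 2 * (z + d + 1)]. *)
have dn : d * (2 * z + 2 * d + 3) <= d * n by rewrite leq_mul2l; lia.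
rewrite dE in le2; have := congr1 (muln n) nE; have := congr1 (muln c) nE.
by have := congr1 (muln z) nE; have := congr1 (muln d) nE; nia.
Qed.

Lemma exists_subset_card {T : finType} {C : {set T}} {m} :
  m <= #|C| -> exists2 B : {set T}, B \subset C & #|B| = m.
Proof.
move=> mC; exists [set x in take m (enum C)].
  by apply/subsetP => x; rewrite inE => /mem_take; rewrite mem_enum.
by rewrite cardsE (card_uniqP _) ?take_uniq ?enum_uniq // size_takel -?cardE.
Qed.

(** * The exact value of [b] *)

Lemma b_formula (z n : nat) : 0 < z -> n != 8 ->
  b z + 3 <= n + z -> n + z < b z.+1 + 2 ->
  b n + z * n = n * n + b z.
Proof.
move=> z0 n8 bn nb.
have b1 := b_ge_self 1; have b2 := b_2_ge; have b3 := b_3_ge.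
have bquad := b_quadratic z z0.
have zn : z.+1 < n.
  by case: z z0 bn bquad {nb} => [|[|[|[|z]]]] // _; rewrite ?mul1n; nia.
have zn2 : z * n <= n * n by rewrite leq_mul2r orbC (ltnW (ltnW zn)).
suff -> : b n = (n - z) * n + b z by rewrite mulnBl; lia.
have zb : z * z + z < n + b z + 1.
  by have [zE|z3] := eqVneq z 3; [subst z; lia | have := bquad z3; lia].
(* The first alternative is what [small_class_arith] needs. For [z = 3], [n >= b 3 >= 7], and with 8
   excluded only [n = 7] can fail. *)
have zb' : z * z + 2 * z < n + b z \/ [/\ z = 3, n = 7 & b z = 7].
  have [zE|z3] := eqVneq z 3; last by left; have := bquad z3; lia.
  subst z; have [n7|n7] := eqVneq n 7; last by left; lia.
  by right; split; lia.
apply: b_eq (b_lower _ _ zn nb) _; first by nia.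
apply/negP => /in_W_rel[r [rr rt wE]].
have [x0 _ cmax] := @arg_maxnP _ (Ordinal (ltn_trans z0 (ltnW zn))) predT
  (fun x => #|rel_class r x|) isT.
have [] := double_rel_weight_max_class rt (fun x => cmax x isT).
have cn : #|rel_class r x0| <= n by rewrite -[X in _ <= X]card_ord max_card.
set C := rel_class r x0 in cn *; rewrite -wE card_ord => le1 le2.
have wE' : ((n - z) * n + b z).+1 + z * n = n * n + b z + 1.
  by rewrite mulnBl; lia.
have [jz|jz] := ltnP z (n - #|C|).
  case: zb' => [zb'|[zE nE bE]]; first exact: small_class_arith le1 le2 wE'.
  (* Here [c <= 3], so [le1] bounds the weight by 35, while it is supposed to be 36. *)
  by move: (#|C|) le1 jz => c; rewrite bE zE nE; lia.
pose D := ~: C; pose I := [set x in D | r x x0 || r x0 x].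
have nE : n = #|C| + #|D| by rewrite cardsC card_ord.
have ID : #|I| <= #|D|.
  by apply/subset_leq_card/subsetP => x; rewrite inE => /andP[].
have wC := rel_weight_class rt (subxx C).
rewrite /= -/C setUCr -wE -/D -/I in wC.
have [] := @class_arith n z (b z) #|C| (#|D| - #|I|) #|D| (rel_weight r D).
all: rewrite ?subKn ?leq_subr ?rel_weight_ge ?rel_weight_le //.
- by clear - jz nE; lia.
- by rewrite -wC addn1.
move=> tz uE.
have mC : #|D| - #|I| <= #|C| by clear - nE tz zn; lia.
have [B BC Bm] := exists_subset_card mC.
case/negP: (b_succ_notin_W z); rewrite -addn1 -uE -Bm.
rewrite -(rel_weight_class rt BC).
have -> : z = #|B :|: D|.
  have BD0 : B :&: D = set0 by apply/eqP; rewrite -setDE setD_eq0.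
  by rewrite cardsU BD0 cards0 subn0 Bm addnC tz.
exact: rel_weight_in_W.
Qed.

Local Open Scope ring_scope.

Theorem theorem1p4 (z n : nat)
    (hz : (1 <= z)%N)
    (hl : ell z <= n%:Z) (hu : n%:Z < ell z.+1)
    (hn : n <> 8%N) :
  (b n)%:Z = n%:Z ^+ 2 - z%:Z * n%:Z + (b z)%:Z.
Proof.
have bz : (b z + 3 <= n + z)%N by move: hl; rewrite /ell; lia.
have bn : (n + z < b z.+1 + 2)%N by move: hu; rewrite /ell; lia.
have /eqP n8 := hn; have := b_formula z n hz n8 bz bn; lia.
Qed.
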